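(* Let $G$ be a finite group of order $|G|=\ell$ and let $2\leq q\leq e_\ell$, where $e_\ell=\min\{m: m \text{ is a prime divisor of } \ell\}$. Suppose that $X$ is a nonempty paracompact free $G$-space with $n_q=\mathrm{ind}_q(X,G)<\infty$. Then \[n_q(q-1)+1\leq \mathrm{secat}(X\to X/G).\]
   Context: ''Space'' means topological space and ''map'' means continuous map. A free $G$-space is a Hausdorff space $X$ on which the finite group $G$ acts freely on the left; $X\to X/G$ denotes the quotient map (a fibration). For a space $Y$, the configuration-like space $F(Y,\ell,q)\subset Y^\ell$ (subspace topology) is the set of all $(y_1,\ldots,y_\ell)\in Y^\ell$ such that for any indices $0<i_1<\cdots<i_q\leq\ell$ at least two of $y_{i_1},\ldots,y_{i_q}$ are different. Fix an enumeration $G=\{g_1,\ldots,g_\ell\}$ and let $h:G\to\{1,\ldots,\ell\}$ be the bijection $h(g_j)=j$. The group $G$ acts on the left on $Y^\ell$ by $g(y_1,\ldots,y_\ell)=(y_{h(g^{-1}g_1)},\ldots,y_{h(g^{-1}g_\ell)})$; this restricts to a left action on $F(Y,\ell,q)$, which is free when $q\leq e_\ell$. The $q$-th index $\mathrm{ind}_q(X,G)$ is the least integer $k\in\{0,1,2,\ldots\}$ such that there exists a $G$-equivariant map $X\to F(\mathbb{R}^{k+1},\ell,q)$, and $\mathrm{ind}_q(X,G)=\infty$ if no such $k$ exists. For a fibration $\pi:E\to B$, the sectional category $\mathrm{secat}(\pi)$ is the minimal cardinality of an open cover of $B$ such that each element $U$ of the cover admits a local section of $\pi$ (a map $s:U\to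 E$ with $\pi\circ s$ equal to the inclusion $U\hookrightarrow B$); $\mathrm{secat}(\pi)=\infty$ if no such finite cover exists. *)

(* Defs.v *)
From HB Require Import structures.
From mathcomp Require Import all_boot all_order all_algebra all_fingroup.
From mathcomp Require Import all_classical all_reals all_analysis.
Import numFieldNormedType.Exports.

Set Implicit Arguments.
Unset Strict Implicit.
Unset Printing Implicit Defensive.

Local Open Scope classical_set_scope.
Local Open Scope quotient_scope.
Local Open Scope card_scope.

(* Extended natural numbers: [None] stands for infinity. *)
Definition enat := option nat.

Definition enat_le (m n : enat) : bool :=
  match m, n with
  | _, None => true
  | None, Some _ => false
  | Some a, Some b => a <= b
  end.

(* The least natural number satisfying [P], infinity if there is none. *)
Definition least (P : nat -> Prop) : enat :=
  if pselect (exists n, `[< P n >]) is left exP then Some (ex_minn exP)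
  else None.

Lemma least_SomeP (P : nat -> Prop) (n : nat) :
  least P = Some n <-> P n /\ (forall m, P m -> n <= m).
Proof.
rewrite /least; case: pselect => [exP|nexP]; last first.
  by split=> // -[Pn _]; case: nexP; exists n; apply/asboolP.
case: ex_minnP => m /asboolP Pm m_min; split=> [[<-]|[Pn n_min]].
  by split=> // k Pk; apply: m_min; apply/asboolP.
by congr Some; apply/eqP; rewrite eqn_leq n_min // m_min //; apply/asboolP.
Qed.

Lemma least_NoneP (P : nat -> Prop) : least P = None <-> forall n, ~ P n.
Proof.
rewrite /least; case: pselect => [exP|nexP]; split=> //.
  by move=> nP; have [n /asboolP /nP] := exP.
by move=> _ n Pn; apply: nexP; exists n; apply/asboolP.
Qed.

(* Infinity when [l = 1] (minimum over the empty set). *)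
Definition least_prime_divisor (l : nat) : enat :=
  least (fun m => prime m /\ m %| l).

Section Covers.
Variable T : topologicalType.

Definition open_cover (U : set (set T)) : Prop :=
  (forall A, U A -> open A) /\ cover U id = [set: T].

Definition refines (V U : set (set T)) : Prop :=
  forall A, V A -> exists2 B, U B & A `<=` B.

Definition locally_finite (V : set (set T)) : Prop :=
  forall x : T, exists2 N, nbhs x N &
    finite_set [set A | V A /\ A `&` N !=set0].

Definition paracompact : Prop :=
  forall U, open_cover U ->
    exists V, [/\ open_cover V, refines V U & locally_finite V].

End Covers.
Arguments paracompact : clear implicits.

Section Secat.
Variables (E B : topologicalType) (pi : E -> B).

(* [U] coerces to the subtype [set_type U], with the subspace topology. *)
Definition has_local_section (U : set B) : Prop :=
  exists s : U -> E, continuous s /\ (forall b : U, pi (s b) = set_val b).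

Definition secat : enat :=
  least (fun k => exists U : set (set B),
    [/\ open_cover U, U #= `I_k & forall V, U V -> has_local_section V]).

End Secat.

(* The group is finite, hence discrete: joint continuity of the action amounts
   to continuity of each translation. *)
Record left_action (gT : finGroupType) (X : topologicalType) := LeftAction {
  lact :> gT -> X -> X;
  lact1 : forall x, lact 1%g x = x;
  lactM : forall g h x, lact (g * h)%g x = lact g (lact h x);
  lact_continuous : forall g, continuous (lact g)
}.

Section FreeSpace.
Variables (gT : finGroupType) (X : topologicalType) (a : left_action gT X).

Definition free_gspace : Prop :=
  hausdorff_space X /\ (forall g x, a g x = x -> g = 1%g).

Definition orbit_rel : rel X := fun x y => [exists g : gT, a g x == y].

Lemma orbit_rel_refl : reflexive orbit_rel.
Proof. by move=> x; apply/existsP; exists 1%g; rewrite lact1. Qed.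

Lemma orbit_rel_sym : symmetric orbit_rel.
Proof.
move=> x y; apply/existsP/existsP => -[g /eqP <-]; exists g^-1%g;
  by rewrite -lactM mulVg lact1.
Qed.

Lemma orbit_rel_trans : transitive orbit_rel.
Proof.
move=> y x z /existsP[g /eqP <-] /existsP[h /eqP <-].
by apply/existsP; exists (h * g)%g; rewrite lactM.
Qed.

Definition orbit_equiv : equiv_rel X :=
  EquivRel orbit_rel orbit_rel_refl orbit_rel_sym orbit_rel_trans.

Definition orbit_space : topologicalType :=
  quotient_topology {eq_quot orbit_equiv}.

Definition orbit_proj : X -> orbit_space := \pi_orbit_space.

End FreeSpace.

(* F(Y, l, q), indices being numbered from 0. *)
Definition config (Y : topologicalType) (l q : nat) : set {ptws 'I_l -> Y} :=
  [set y | forall i : 'I_q -> 'I_l, {homo i : s t / (s < t)%N} ->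
     exists s t, y (i s) <> y (i t)].
Arguments config : clear implicits.

Section Index.
Variables (gT : finGroupType) (l : nat).
(* Intended to be mutually inverse: [gs] enumerates the group, and [h g] is the
   position of [g]. *)
Variables (gs : 'I_l -> gT) (h : gT -> 'I_l).

Definition tuple_act (Y : topologicalType) (g : gT)
    (y : {ptws 'I_l -> Y}) : {ptws 'I_l -> Y} :=
  fun j => y (h (g^-1 * gs j)%g).

(* [tuple_act] only permutes coordinates, so it preserves [config]; the
   restricted action is compared inside the full product. *)
Definition has_equivariant_map (X : topologicalType) (a : left_action gT X)
    (Y : topologicalType) (q : nat) : Prop :=
  exists f : X -> config Y l q, continuous f /\
    (forall g x, set_val (f (a g x)) = tuple_act g (set_val (f x))).

Definition gindex (R : realType) (X : topologicalType) (a : left_action gT X)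
    (q : nat) : enat :=
  least (fun k => has_equivariant_map a 'rV[R]_k.+1 q).

End Index.

(* Main.v *)
(* Let X/G be covered by m open sets U_i with sections s_i. Over U_i, writing
   x = c_i(x) s_i([x]) gives a locally constant equivariant c_i : X|U_i -> G.
   Since X is normal, there are continuous invariant t_i >= 0, supported over
   U_i and without common zero. For vectors v_i(g) in R^d, the function
   phi(x) = sum_i t_i(x) v_i(c_i(x)) agrees at q points g_a x of an orbit iff
   sum_i t_i(x) (v_i(g_a c_i(x)) - v_i(g_0 c_i(x))) = 0 for
   0 < a < q, which is a system of d(q-1) linear equations in the t_i(x). If
   m <= d(q-1) and the v_i(g) are generic, only t = 0 solves it, so
   x |-> (phi(g_j^-1 x))_j is an equivariant map X -> F(R^d, l, q) and
   ind_q(X, G) < d. *)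

Require Import Defs.
From mathcomp Require Import all_boot all_order all_algebra all_fingroup.
From mathcomp Require Import all_classical all_reals all_analysis.
Import Order.TTheory GRing.Theory Num.Theory.
Import numFieldNormedType.Exports.

Set Implicit Arguments.
Unset Strict Implicit.
Unset Printing Implicit Defensive.

Local Open Scope classical_set_scope.

(** * Vectors in general position *)

Section GeneralPosition.
Local Open Scope ring_scope.

(** The product of the [p i] has finitely many roots, while characteristic zero makes the candidates
    [k%:R] pairwise distinct. *)
Lemma common_nonroot (F : numDomainType) (I : finType) (P : pred I)
    (p : I -> {poly F}) :
  (forall i, P i -> p i != 0) -> exists x, forall i, P i -> (p i).[x] != 0.
Proof.
move=> p_neq0; pose r := \prod_(i | P i) p i.
have r_neq0 : r != 0 by apply/prodf_neq0.
pose s := [seq k%:R : F | k <- iota 0 (size r)].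
have s_uniq : uniq s by rewrite map_inj_uniq ?iota_uniq //; apply: mulrIn.
have /allPn [x _ rx] : ~~ all (root r) s.
  apply/negP => /(max_poly_roots r_neq0)/(_ s_uniq).
  by rewrite size_map size_iota ltnn.
exists x => i Pi; move: rx; rewrite /root horner_prod => /prodf_neq0; exact.
Qed.

(** A matrix with more rows than columns has a nonzero left kernel. *)
Lemma underdetermined_system (F : fieldType) (T : finType) (m : nat)
    (D : 'I_m -> T -> F) :
  (m < #|T|)%N ->
  exists2 e : T -> F, exists p, e p != 0 & forall i, \sum_p e p * D i p = 0.
Proof.
move=> m_lt; pose A := \matrix_(j < #|T|, i < m) D i (enum_val j).
have : kermx A != 0.
  by rewrite kermx_eq0 /row_free neq_ltn (leq_ltn_trans (rank_leq_col A)).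
case/rowV0Pn => u /sub_kermxP uA /matrix0Pn [i0 [j uj]].
exists (fun p => u 0 (enum_rank p)).
  by exists (enum_val j); rewrite enum_valK -(ord1 i0).
move=> i; have /matrixP/(_ 0 i) := uA; rewrite mxE [RHS]mxE; apply: etrans.
rewrite (reindex _ (onW_bij _ (enum_val_bij T))) /=; apply: eq_bigr => k _.
by rewrite enum_valK mxE.
Qed.

(* The vectors are chosen one block [v i] at a time. For the new block, every
   choice of [g] and [c] leaves a linear form vanishing on the previous columns,
   and the entries of the block are distinct powers of a number [x] that is not
   a root of the finitely many polynomials these forms then become. *)
Lemma general_position (F : numFieldType) (gT : finGroupType) (d q m : nat) :
  (m <= q * d)%N ->
  exists v : nat -> gT -> 'rV[F]_d,
    forall (g : 'I_q.+1 -> gT) (c : nat -> gT) (t : nat -> F), injective g ->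
    (forall a b, \sum_(i < m) t i *: v i (g a * c i)%g =
                 \sum_(i < m) t i *: v i (g b * c i)%g) ->
    forall i, (i < m)%N -> t i = 0.
Proof.
elim: m => [_|m IHm m_lt]; first by exists (fun _ _ => 0).
have [v v_gen] := IHm (ltnW m_lt).
pose T := ('I_q * 'I_d)%type.
(* Agreement at all [q.+1] points is agreement with the base point [g ord0], that is, [q * d] scalar
   equations indexed by [T]. *)
pose diff (w : gT -> 'rV[F]_d) (g : 'I_q.+1 -> gT) y (p : T) :=
  w (g (lift ord0 p.1) * y)%g 0 p.2 - w (g ord0 * y)%g 0 p.2.
pose I := ({ffun 'I_q.+1 -> gT} * {ffun 'I_m -> gT})%type.
have /choice[e eP] (z : I) : exists e : T -> F, (exists p, e p != 0) /\
    forall i : 'I_m, \sum_p e p * diff (v i) z.1 (z.2 i) p = 0.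
  have [|e e0 eD] := @underdetermined_system F T m
    (fun i => diff (v i) z.1 (z.2 i)); first by rewrite card_prod !card_ord.
  by exists e.
pose idx (h : gT) (k : 'I_d) : nat := enum_rank (h, k).
have idx_inj h k h' k' : (idx h k == idx h' k') = ((h, k) == (h', k')).
  by rewrite (inj_eq val_inj) (inj_eq enum_rank_inj).
pose P (z : I * gT) := \sum_(p : T) (e z.1 p) *:
  ('X^(idx (z.1.1 (lift ord0 p.1) * z.2)%g p.2)
   - 'X^(idx (z.1.1 ord0 * z.2)%g p.2)).
(* Since [g] is injective, the monomial attached to [(a, k)] occurs in no other summand, so its
   coefficient in [P z] is the entry of [e] at [(a, k)]. *)
have P_neq0 (z : I * gT) : injectiveb z.1.1 -> P z != 0.
  move=> /injectiveP g_inj; have [[[a k] ep] _] := eP z.1.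
  apply: contra_neq ep => Pz0.
  have := congr1 (fun r : {poly F} =>
    r`_(idx (z.1.1 (lift ord0 a) * z.2)%g k)) Pz0.
  rewrite coef0 coef_sum (bigD1 (a, k)) //= big1 ?addr0.
    rewrite coefZ coefB !coefXn eqxx idx_inj xpair_eqE eqxx andbT.
    rewrite (inj_eq (mulIg _)) (inj_eq g_inj) lift_eqF subr0 mulr1.
    exact: id.
  case=> b j; rewrite xpair_eqE /= => neq.
  rewrite coefZ coefB !coefXn !idx_inj !xpair_eqE !(inj_eq (mulIg _)).
  rewrite !(inj_eq g_inj) (inj_eq (@lift_inj _ ord0)) lift_eqF.
  by rewrite (eq_sym a) (eq_sym k) (negPf neq) subrr mulr0.
have [x xP] := common_nonroot P_neq0.
pose w (h : gT) : 'rV[F]_d := \row_k x ^+ idx h k.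
exists (fun i => if i == m then w else v i) => g c t g_inj eq_t.
pose z : I := ([ffun a => g a], [ffun i : 'I_m => c i]).
have eq_t' a b : \sum_(i < m) t i *: v i (g a * c i)%g + t m *: w (g a * c m)%g
               = \sum_(i < m) t i *: v i (g b * c i)%g + t m *: w (g b * c m)%g.
  have := eq_t a b; rewrite !big_ord_recr /= eqxx.
  have E f : \sum_(i < m) t i *: (if i == m :> nat then w else v i) (f i)
           = \sum_(i < m) t i *: v i (f i).
    by apply: eq_bigr => i _; rewrite ltn_eqF.
  by rewrite !(E (fun i => (_ * c i)%g)).
(* The form [e z] kills the first [m] columns, leaving [t m] times the value of [P (z, c m)] at [x],
   which is nonzero. *)
have tm0 : t m = 0.
  have [_ ev] := eP z.
  have diff_eq0 p : \sum_(i < m) t i * diff (v i) g (c i) p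
                    + t m * diff w g (c m) p = 0.
    have /matrixP/(_ 0 p.2) := eq_t' (lift ord0 p.1) ord0.
    rewrite !mxE !summxE => /eqP; rewrite -subr_eq0 => /eqP; apply: etrans.
    rewrite opprD addrACA -sumrB mulrBr; congr (_ + _); last by rewrite !mxE.
    by apply: eq_bigr => i _; rewrite !mxE mulrBr.
  have /xP : injectiveb (z, c m).1.1.
    by apply/injectiveP => a b; rewrite !ffunE => /g_inj.
  apply: contraNeq => tm_neq0; apply/eqP/(mulfI tm_neq0); rewrite mulr0.
  rewrite /P horner_sum mulr_sumr.
  transitivity (\sum_p (- \sum_(i < m) t i * (e z p * diff (v i) g (c i) p))).
    apply: eq_bigr => p _; have /eqP := diff_eq0 p.
    rewrite addrC addr_eq0 => /eqP tm_eq.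
    rewrite hornerZ hornerD hornerN !hornerXn !ffunE mulrCA.
    rewrite /diff !mxE in tm_eq; rewrite tm_eq mulrN mulr_sumr; congr (- _).
    by apply: eq_bigr => i _; rewrite mulrCA.
  rewrite sumrN exchange_big big1 ?oppr0 // => i _; rewrite -mulr_sumr.
  apply/eqP; rewrite mulf_eq0; apply/orP; right; apply/eqP.
  by apply: etrans (ev i); apply: eq_bigr => p _; rewrite /diff !ffunE.
move=> i; rewrite ltnS leq_eqVlt => /predU1P[-> //|].
apply: (v_gen g c t g_inj) => a b; have := eq_t' a b.
by rewrite tm0 !scale0r !addr0.
Qed.
End GeneralPosition.

(** * Paracompact Hausdorff spaces are normal *)

Section Paracompact.
Variable (X : topologicalType).
Hypotheses (Xparacompact : paracompact X) (Xhausdorff : hausdorff_space X).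

(** Local finiteness makes closure commute with unions of members, so neighbourhoods avoiding [B]
    point by point can be glued along [A]. *)
Lemma paracompact_separate (A B : set X) : closed A ->
  (forall y, A y -> exists U, [/\ open U, U y & closure U `&` B = set0]) ->
  exists W, [/\ open W, A `<=` W & closure W `&` B = set0].
Proof.
move=> clA AB.
pose U := [set D : set X | open D /\ (D `<=` ~` A \/ closure D `&` B = set0)].
have [|V [[Vo Vc] VU Vlf]] := Xparacompact (U := U).
  split=> [D [] // |]; apply/seteqP; split=> // x _.
  have [Ax|nAx] := pselect (A x).
    by have [D [Do Dx DB]] := AB _ Ax; exists D => //; split; [|right].
  by exists (~` A) => //; split; [exact: closed_openC|left].
(* A member meeting [A] does not lie in the complement of [A], so its closure misses [B]. *)
pose VA := [set D | V D /\ D `&` A !=set0].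
exists (\bigcup_(D in VA) D); split.
- by apply: bigcup_open => D [/Vo].
- move=> x Ax; have : [set: X] x by [].
  by rewrite -Vc => -[D VD Dx]; exists D => //; split=> //; exists x.
rewrite -subset0 => x [clx Bx].
have [N Nx Nfin] := Vlf x.
have D_far D : VA D -> ~ closure D x.
  move=> [VD [y [Dy Ay]]] Dx; have [D' [_ DA]] := VU _ VD.
  move=> DD'; case: DA => [/(_ y (DD' _ Dy))//|/seteqP[+ _]] => /(_ x).
  by apply; split=> //; exact: closureS Dx.
(* Only finitely many members meet [N], so [C] is closed and [N] minus [C] is a neighbourhood of [x]
   disjoint from the union over [VA]. *)
pose C := \bigcup_(D in [set D | V D /\ D `&` N !=set0] `&` VA) closure D.
have Ccl : closed C.
  apply: closed_bigcup => [|D _]; last exact: closed_closure.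
  exact: sub_finite_set Nfin.
have : nbhs x (N `&` ~` C).
  apply: filterI => //; apply: open_nbhs_nbhs; split; first exact: closed_openC.
  by move=> -[D [_ /D_far]].
move=> /clx [y [[D VD Dy] [Ny]]]; apply; exists D; last exact: subset_closure.
by split=> //; split; [case: VD|exists y].
Qed.

(** Separation is applied twice: Hausdorffness yields it for a closed set and a point, and this
    yields it for two closed sets. *)
Lemma paracompact_normal (R : realType) : normal_space X.
Proof.
have := Xhausdorff; rewrite open_hausdorff => sep.
have regular (A : set X) x : closed A -> ~ A x ->
    exists W, [/\ open W, A `<=` W & closure W `&` [set x] = set0].
  move=> clA nAx; apply: paracompact_separate => // y Ay.
  have xy : y != x by apply: contra_notN nAx => /eqP <-.
  have [[U V] /= [/set_mem Uy /set_mem Vx] [Uo Vo /eqP UV]] := sep y x xy.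
  exists U; split=> //; rewrite -subset0 => z [/[swap] -> clz].
  have [|u [Uu Vu]] := clz V; first exact: open_nbhs_nbhs.
  by have : set0 u by rewrite -UV.
apply/(@normal_openP R) => A B clA clB AB.
have [|W [Wo AW WB]] := @paracompact_separate A B clA.
  move=> y Ay; have nBy : ~ B y by move=> By; have : set0 y by rewrite -AB.
  have [W [Wo BW Wy]] := regular B y clB nBy.
  (* The open set [W] contains [B] and is disjoint from this complement, hence also from its
     closure. *)
  exists (~` closure W); split.
  - exact/closed_openC/closed_closure.
  - by move=> clWy; have : set0 y by rewrite -Wy.
  rewrite -subset0 => z [clz /BW Wz]; have [|u [+ Wu]] := clz W.
    exact: open_nbhs_nbhs.
  by apply; exact: subset_closure.
exists W, (~` closure W); split => //.
- exact/closed_openC/closed_closure.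
- by move=> x Bx clWx; have : set0 x by rewrite -WB.
by rewrite -subset0 => x [/subset_closure].
Qed.

End Paracompact.

(** * Bump functions subordinate to a finite open cover *)

Section Bumps.
Local Open Scope ring_scope.
Variables (R : realType) (X : topologicalType).
Hypothesis Xnormal : normal_space X.

(** A Urysohn function supported in the last set is 1 on the part of [C] that the earlier sets miss.
    Its zeros in [C] form a closed set covered by the earlier sets, to which induction applies. *)
Lemma normal_bump_functions (m : nat) (V : nat -> set X) (C : set X) :
  closed C -> (forall i, (i < m)%N -> open (V i)) ->
  (forall x, C x -> exists2 i, (i < m)%N & V i x) ->
  exists t : nat -> X -> R, [/\ forall i, continuous (t i),
    forall i x, 0 <= t i x,
    forall i x, ~ V i x -> t i x = 0 &
    forall x, C x -> exists2 i, (i < m)%N & t i x != 0].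
Proof.
elim: m C => [|m IHm] C clC Vo CV.
  exists (fun _ _ => 0); split=> // [i|x /CV[]//]; exact: cst_continuous.
pose rest := \bigcup_(i in `I_m) V i.
have rest_o : open rest by apply: bigcup_open => i /= im; apply/Vo/ltnW.
have Vm_o : open (V m) by exact: Vo.
have [||| f [fc f0 f1 f01]] :=
    @urysohn_ext_itv X R Xnormal (~` V m) (C `\` rest) 0 1 _ _ _ ltr01.
- exact: open_closedC.
- by apply: closedI => //; exact: open_closedC.
- rewrite -subset0 => x [nVx [Cx nrx]].
  have [i] := CV _ Cx; rewrite ltnS leq_eqVlt => /predU1P[-> //|im Vx].
  by apply: nrx; exists i.
have C'cl : closed (C `&` f @^-1` [set 0]).
  apply: closedI => //; apply: preimage_closed => //; exact: closed_eq.
have [||t [tc t0 tV tC]] := IHm _ C'cl.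
- by move=> i im; apply/Vo/ltnW.
- move=> x [Cx fx0]; apply: contrapT => nex.
  have : f x = 1.
    by apply: f1; exists x => //; split=> // -[i im Vx]; apply: nex; exists i.
  by rewrite fx0 => /eqP; rewrite eq_sym oner_eq0.
exists (fun i => if i == m then f else t i); split=> [i|i x|i x|x Cx].
- by case: ifP.
- case: ifP => // _; have /f01 : range f (f x) by exists x.
  by rewrite /= in_itv /= => /andP[].
- case: ifP => [/eqP ->|_]; last exact: tV.
  by move=> nVx; apply: f0; exists x.
have [fx0|fx0] := eqVneq (f x) 0; last by exists m; rewrite ?eqxx.
have [//|i im tx] := tC x; exists i; first exact: ltnW.
by rewrite ltn_eqF.
Qed.
End Bumps.

(** * Continuity criteria *)

Section Continuity.
Local Open Scope ring_scope.

Lemma continuous_ptws (T Y : topologicalType) (I : Type)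
    (f : T -> {ptws I -> Y}) :
  (forall i, continuous (fun x => f x i)) -> continuous f.
Proof.
move=> fc x; apply/cvg_sup => i.
exact: (@continuous_comp_initial _ T Y (fun y : I -> Y => y i) f (fc i)).
Qed.

(** At a zero of [f], where [c] may jump, finiteness of [I] bounds [w (c y)] and the product still
    tends to 0. *)
Lemma continuous_scale_locally_constant (R : realType) (X : topologicalType)
    (V : normedModType R) (I : finType) (f : X -> R) (c : X -> I) (w : I -> V) :
  continuous f ->
  (forall x, f x != 0 -> \forall y \near x, c y = c x) ->
  continuous (fun x => f x *: w (c x)).
Proof.
move=> fc c_const x; have [fx0|fx0] := eqVneq (f x) 0; last first.
  apply: (@cvg_trans _ ((fun y => f y *: w (c x)) @ x)).
    apply: near_eq_cvg; have := c_const _ fx0.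
    by apply: filterS => y /= ->.
  by apply: cvgZr_tmp; exact: fc.
rewrite /continuous_at fx0 scale0r; apply/norm_cvg0P.
pose M : R := \sum_i `|w i|.
apply: (@squeeze_cvgr _ _ _ _ (fun=> 0) (fun y => `|f y| * M)).
- apply: nearW => y; rewrite normr_ge0 normrZ ler_wpM2l //.
  by rewrite /M (bigD1 (c y)) //= lerDl sumr_ge0.
- exact: cvg_cst.
- have -> : (0 : R) = `|f x| * M by rewrite fx0 normr0 mul0r.
  by apply: cvgMr_tmp; apply: cvg_norm; exact: fc.
Qed.
End Continuity.

(** * Equivariant charts from local sections *)

Section Charts.
Variables (gT : finGroupType) (X : topologicalType) (a : left_action gT X).
Hypothesis a_free : free_gspace a.

Lemma orbit_projP x y :
  orbit_proj a x = orbit_proj a y <-> exists g, a g x = y.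
Proof.
split=> [/eqmodP/existsP[g /eqP]|[g agx]]; first by exists g.
by apply/eqmodP/existsP; exists g; rewrite agx.
Qed.

Lemma free_lact_inj x g h : a g x = a h x -> g = h.
Proof.
move=> gh; apply/eqP; rewrite eq_mulVg1; apply/eqP.
by apply: (a_free.2 _ x); rewrite lactM -gh -lactM mulVg lact1.
Qed.

(** Here [c x] carries the section's point on the orbit of [x] to [x]. Freeness makes it unique,
    hence equivariant; it is locally constant because the space is Hausdorff and the group
    finite. *)
Lemma local_section_chart (U : set (orbit_space a)) :
  open U -> has_local_section (orbit_proj a) U ->
  exists c : X -> gT, forall x, U (orbit_proj a x) ->
    (forall g, c (a g x) = g * c x)%g /\ \forall y \near x, c y = c x.
Proof.
move=> Uo [s [sc sK]].
have Vo : open (orbit_proj a @^-1` U) by exact: Uo.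
(* Over [U] this is the section at the orbit of [x]; elsewhere [x] is an arbitrary default. *)
pose sg x := match pselect (U (orbit_proj a x)) with
  | left Ux => s (exist _ (orbit_proj a x) (mem_set Ux)) | right _ => x end.
have sgK x : U (orbit_proj a x) -> orbit_proj a (sg x) = orbit_proj a x.
  by rewrite /sg; case: pselect => // Ux _; rewrite sK.
have sg_inv g x : U (orbit_proj a x) -> sg (a g x) = sg x.
  move=> Ux; have E : orbit_proj a (a g x) = orbit_proj a x.
    by apply/esym/orbit_projP; exists g.
  rewrite /sg; do 2 case: pselect => //; rewrite E // => U1 U2.
  by congr s; exact/val_inj.
have sg_cont x : U (orbit_proj a x) -> {for x, continuous sg}.
  move=> Ux; rewrite /prop_for /continuous_at {2}/sg.
  case: pselect => // Ux' N Nx; have [_ [[W Wo <-] /= Wx WN]] := sc _ _ Nx.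
  have : open_nbhs x (orbit_proj a @^-1` (W `&` U)).
    split=> //; exact: openI.
  move=> /open_nbhs_nbhs; apply: filterS => y [Wy Uy].
  rewrite /= /sg; case: pselect => // Uy'; exact: WN.
have /choice[c cP] x : exists g, U (orbit_proj a x) -> a g (sg x) = x.
  have [Ux|nUx] := pselect (U (orbit_proj a x)); last by exists 1%g.
  by have /orbit_projP[g gx] := sgK _ Ux; exists g.
have U_act g x : U (orbit_proj a x) -> U (orbit_proj a (a g x)).
  by have /orbit_projP <- : exists k, a k x = a g x by exists g.
exists c => x Ux; split=> [g|].
  apply: (@free_lact_inj (sg x)); rewrite lactM cP // -(sg_inv g) //.
  by apply: cP; exact: U_act.
have := a_free.1; rewrite open_hausdorff => sep.
(* If [g] differs from [c x], disjoint neighbourhoods of [a g (sg x)] and [x] exclude [c y = g] for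
   [y] near [x]. *)
have far (g : gT) : \forall y \near x, g != c x -> a g (sg y) != y.
  have [->|gcx] := eqVneq g (c x); first by apply: nearW.
  have gx : a g (sg x) != x.
    apply: contra_neq gcx => gx; apply: (@free_lact_inj (sg x)).
    by rewrite gx cP.
  have [[A B] /= [/set_mem Ax /set_mem Bx] [Ao Bo /eqP AB]] := sep _ _ gx.
  have nA : nbhs x ((a g \o sg) @^-1` A).
    apply: (continuous_comp (sg_cont _ Ux)); first exact: lact_continuous.
    exact: open_nbhs_nbhs.
  have nB : nbhs x B by exact: open_nbhs_nbhs.
  apply: filterS2 nA nB => y /= Ay By _; apply/eqP => gy.
  by have : set0 y by rewrite -AB; split=> //; rewrite -gy.
have nV : nbhs x (orbit_proj a @^-1` U) by exact: open_nbhs_nbhs.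
apply: filterS2 (filter_forall _ far) nV => y /= yfar Uy.
by apply/eqP; apply: contraT => /yfar; rewrite cP // eqxx.
Qed.

End Charts.

(** * Equivariant maps into configuration spaces *)

Section EquivariantMaps.
Local Open Scope ring_scope.
Variables (R : realType) (gT : finGroupType) (l : nat).
Variables (gs : 'I_l -> gT) (h : gT -> 'I_l).
Hypotheses (gsK : cancel gs h) (hK : cancel h gs).
Variables (X : topologicalType) (a : left_action gT X).

Lemma has_equivariant_map_of_function (d q : nat) (phi : X -> 'rV[R]_d.+1) :
  continuous phi ->
  (forall x (g : 'I_q -> gT), injective g -> exists s t,
     phi (a (g s) x) <> phi (a (g t) x)) ->
  has_equivariant_map gs h a 'rV[R]_d.+1 q.
Proof.
move=> phi_cont phi_sep.
(* The inverse turns translation of [x] into the coordinate permutation [tuple_act]. *)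
pose f x : {ptws 'I_l -> 'rV[R]_d.+1} := fun j => phi (a (gs j)^-1%g x).
have f_config x : config 'rV[R]_d.+1 l q (f x).
  move=> i i_mono; apply: (phi_sep x (fun s => (gs (i s))^-1%g)).
  move=> s t /invg_inj/(can_inj gsK) ist.
  apply/eqP; rewrite eq_le !leNgt; apply/andP; split; apply/negP => /i_mono.
    by rewrite ist ltnn.
  by rewrite ist ltnn.
exists (fun x => exist _ (f x) (mem_set (f_config x))); split.
  apply: continuous_comp_initial; apply: continuous_ptws => j x.
  by apply: continuous_comp; [exact: lact_continuous|exact: phi_cont].
move=> g x; apply: funext => j; rewrite /tuple_act !set_valE /= /f hK.
by rewrite invMg invgK lactM.
Qed.

Hypotheses (X_paracompact : paracompact X) (X_free : free_gspace a).

Lemma equivariant_map_of_sections (d q m : nat)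
    (u : nat -> set (orbit_space a)) :
  (m <= d.+1 * q)%N ->
  (forall i, (i < m)%N -> open (u i)) ->
  (forall i, (i < m)%N -> has_local_section (orbit_proj a) (u i)) ->
  (forall b, exists2 i, (i < m)%N & u i b) ->
  has_equivariant_map gs h a 'rV[R]_d.+1 q.+1.
Proof.
move=> m_le u_open u_sec u_cover.
have /choice[c cP] i : exists c : X -> gT,
    (i < m)%N -> forall x, u i (orbit_proj a x) ->
    (forall g, c (a g x) = g * c x)%g /\ \forall y \near x, c y = c x.
  have [im|im] := boolP (i < m)%N; last by exists (fun=> 1%g).
  have [c cP] := local_section_chart X_free (u_open _ im) (u_sec _ im).
  by exists c.
have [|i im|x _|t [tc t0 tV tC]] := @normal_bump_functions R X
    (paracompact_normal X_paracompact X_free.1 R) m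
    (fun i => orbit_proj a @^-1` u i) [set: X].
- exact: closedT.
- exact: u_open.
- exact: u_cover.
(* Summing over the group makes the bump functions invariant; nonnegativity rules out
   cancellation. *)
pose T i x := \sum_g t i (a g x).
have T_inv i g x : T i (a g x) = T i x.
  rewrite /T [RHS](reindex_inj (mulIg g)).
  by apply: eq_bigr => k _; rewrite lactM.
have T_cont i : continuous (T i).
  apply: continuous_big => [|g _ x]; first exact: add_continuous.
  by apply: continuous_comp; [exact: lact_continuous|exact: tc].
have T_supp i x : T i x != 0 -> u i (orbit_proj a x).
  apply: contra_neqP => nux; rewrite /T big1 // => g _; apply: tV => /=.
  by have /orbit_projP <- : exists k, a k x = a g x by exists g.
have T_neq0 x : exists2 i, (i < m)%N & T i x != 0.
  have [//|i im tx] := tC x; exists i => //.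
  rewrite gt_eqF // /T (bigD1 1%g) //= lact1 ltr_wpDr ?sumr_ge0 //.
  by rewrite lt0r tx t0.
have [|v v_gen] := @general_position R gT d.+1 q m; first by rewrite mulnC.
pose phi x := \sum_(i < m) T i x *: v i (c i x).
apply: (@has_equivariant_map_of_function d q.+1 phi).
  apply: continuous_big => [|i _]; first exact: add_continuous.
  apply: continuous_scale_locally_constant => [|x /T_supp ux].
    exact: T_cont.
  by have [] := cP _ (ltn_ord i) x ux.
move=> x g g_inj; apply: contrapT => nex.
have [i im] := T_neq0 x; apply/negP; rewrite negbK; apply/eqP.
have phi_act k : phi (a k x) = \sum_(i < m) T i x *: v i (k * c i x)%g.
  apply: eq_bigr => j _; rewrite T_inv.
  have [->|/T_supp ux] := eqVneq (T j x) 0.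
    by rewrite !scale0r.
  by have [-> ] := cP _ (ltn_ord j) x ux.
(* If [phi] were constant on the points [a (g s) x], general position would force every [T i x] to
   vanish. *)
apply: (v_gen g (fun i => c i x) (fun i => T i x) g_inj) im => b1 b2.
rewrite -!phi_act; apply: contrapT => ne.
by apply: nex; exists b1, b2.
Qed.

End EquivariantMaps.

Theorem theorem3p14 (R : realType) (gT : finGroupType) (l : nat)
    (card_G : #|[set: gT]%SET| = l)
    (gs : 'I_l -> gT) (h : gT -> 'I_l)
    (gsK : cancel gs h) (hK : cancel h gs)
    (q : nat) (q_ge2 : 2 <= q)
    (q_le : enat_le (Some q) (least_prime_divisor l))
    (X : topologicalType) (a : left_action gT X)
    (X_nonempty : [set: X] !=set0) (X_paracompact : paracompact X)
    (X_free : free_gspace a)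
    (n : nat) (n_index : gindex gs h R a q = Some n) :
  enat_le (Some (n * (q - 1) + 1)) (secat (orbit_proj a)).
Proof.
case E: (secat _) => [m|] //=; have [x0 _] := X_nonempty.
have [[U [[Uo Uc] Um Us]] _] := (least_SomeP _ _).1 E.
have [_ n_min] := (least_SomeP _ _).1 n_index.
have := Um; rewrite card_eq_sym => /card_set_bijP[u [uU _ u_surj]].
have u_cover b : exists2 i, i < m & u i b.
  have : [set: orbit_space a] b by [].
  by rewrite -Uc => -[A /u_surj[i im <-] uib]; exists i.
rewrite addn1 ltnNge; apply/negP => m_le.
(* For index 0 the cover would be empty, although the orbit space has a point. *)
case: n n_min m_le {n_index} => [|d] n_min m_le.
  have [i im _] := u_cover (orbit_proj a x0).
  by move: im; rewrite ltnNge (leq_trans m_le).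
(* For index [d.+1], such a cover gives a map into the configuration space of dimension [d.+1], so
   the index is at most [d]. *)
have /n_min : has_equivariant_map gs h a 'rV[R]_d.+1 q.
  have -> : q = (q - 1).+1 by rewrite subn1 prednK // (ltn_trans _ q_ge2).
  apply: (@equivariant_map_of_sections R gT l gs h gsK hK X a
    X_paracompact X_free d (q - 1) m u m_le _ _ u_cover).
    by move=> i /uU /Uo.
  by move=> i /uU /Us.
by rewrite ltnn.
Qed.
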